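(* Let $X$ be a simplicial complex on a vertex set $V$ with $|V|=n$. Then for every integer $k\geq 0$ and every $1\leq i\leq f_k(X)$, \[ \lambda_i(L_k(X))\geq S_{k+1,i}(L(G_X)+J)-kn-\max_{\sigma\in X(k)}\sum_{j=0}^{k+1}(j+1)\cdot \bigl|\sigma[j]\bigr|. \]
   Context: A simplicial complex $X$ on a finite vertex set $V$ is a collection of subsets of $V$ containing every singleton $\{v\}$, $v\in V$, and closed under taking subsets. For $\sigma\in X$, the link is $\operatorname{lk}_X(\sigma)=\{\tau\in X\mid \sigma\cup\tau\in X,\ \sigma\cap\tau=\emptyset\}$; for a vertex $u$ we write $u\in\operatorname{lk}_X(\sigma)$ to mean $\{u\}\in\operatorname{lk}_X(\sigma)$. $X(k)$ is the set of faces of dimension $k$ (i.e. of size $k+1$), $f_k(X)=|X(k)|$. $G_X$ is the graph with vertex set $V$ and edge set $X(1)$. For a graph $G$, $L(G)\in\mathbb{R}^{V\times V}$ is its Laplacian: $L(G)_{u,u}=\deg_G(u)$, $L(G)_{u,v}=-1$ if $\{u,v\}$ is an edge, $0$ otherwise; $J$ is the all-ones $V\times V$ matrix. Fix a linear order $<$ on $V$. For $\sigma\in X(k-1)$, $\tau\in X(k)$ with $\sigma\subset\tau$, let $(\tau:\sigma)=(-1)^{|\{v\in\tau\mid v<u\}|}$ where $u$ is the unique vertex of $\tau\setminus\sigma$. The $k$-th boundary map $\partial_k(X)\in\mathbb{R}^{X(k-1)\times X(k)}$ has entries $(\tau:\sigma)$ if $\sigma\subset\tau$ and $0$ otherwise,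 and the $k$-dimensional combinatorial Laplacian is $L_k(X)=\partial_{k+1}(X)\partial_{k+1}(X)^T+\partial_k(X)^T\partial_k(X)\in\mathbb{R}^{X(k)\times X(k)}$. For a real-spectrum $m\times m$ matrix $M$, $\lambda_i(M)$ is its $i$-th smallest eigenvalue, and $S_{k,i}(M)$ is the $i$-th smallest element of the multiset $\{\sum_{j\in A}\lambda_j(M)\mid A\in\binom{[m]}{k}\}$. For $k\geq0$, $\sigma\in X(k)$ and $0\leq j\leq k+1$, $\sigma[j]$ is the set of vertices $u\in V$ such that $u\notin\operatorname{lk}_X(\sigma)$, $u\in\operatorname{lk}_X(v)$ for all $v\in\sigma$, and $|\{w\in\sigma : u\in\operatorname{lk}_X(\sigma\setminus\{w\})\}|=j$. *)

(* Defs.v *)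
From HB Require Import structures.
From mathcomp Require Import all_boot all_order all_algebra.
From mathcomp Require Import polyrcf.
From mathcomp Require Import reals.

Set Implicit Arguments.
Unset Strict Implicit.
Unset Printing Implicit Defensive.

Import Order.TTheory GRing.Theory Num.Theory.
Local Open Scope ring_scope.

(* The real eigenvalues of M in nondecreasing order, each repeated according  *)
(* to its multiplicity as a root of char_poly M (rootsR is sorted and         *)
(* duplicate-free).  This is the whole spectrum when M has real spectrum.     *)
Definition spectrum (R : rcfType) (m : nat) (M : 'M[R]_m) : seq R :=
  flatten [seq nseq (mup x (char_poly M)) x | x <- rootsR (char_poly M)].

(* Indices i are 1-based in eigenval and eigensum.                            *)
Definition eigenval (R : rcfType) (m : nat) (M : 'M[R]_m) (i : nat) : R :=
  nth 0 (spectrum M) i.-1.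

(* S_{k,i}(M); the ordinal j : 'I_m is the 0-based rank of an eigenvalue.     *)
Definition eigensum (R : rcfType) (m : nat) (M : 'M[R]_m) (k i : nat) : R :=
  nth 0 (sort <=%R
    [seq \sum_(j in A) eigenval M j.+1
      | A : {set 'I_m} <- enum [set A : {set 'I_m} | #|A| == k]]) i.-1.

(* e is meant to be symmetric and irreflexive.                                *)
Definition graph_laplacian (R : rcfType) (V : finType) (e : rel V) :
    'M[R]_#|V| :=
  \matrix_(i, j)
    let u : V := enum_val i in let v : V := enum_val j in
    if u == v then #|[set w | e u w]|%:R else if e u v then -1 else 0.

Section SimplicialComplex.
Variables (d : Order.disp_t) (V : finOrderType d).
Implicit Types (X : {set {set V}}) (sigma tau : {set V}).

Definition simplicial_complex X : Prop :=
  (forall v : V, [set v] \in X) /\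
  (forall sigma tau, sigma \in X -> tau \subset sigma -> tau \in X).

(* Faces are indexed by cardinality rather than by dimension, so that the     *)
(* (-1)-dimensional ones are covered: X(k) is faces X k.+1.                   *)
Definition faces X (s : nat) : {set {set V}} := [set sigma in X | #|sigma| == s].

Definition link X sigma : {set {set V}} :=
  [set tau in X | (sigma :|: tau \in X) && (sigma :&: tau == set0)].

Definition skeleton X : rel V :=
  fun u v => (u != v) && ([set u; v] \in faces X 2).

(* (tau : sigma).  It is used only when tau :\: sigma is a singleton, and     *)
(* then the sum has exactly one term.                                         *)
Definition incidence (R : rcfType) tau sigma : R :=
  \sum_(u in tau :\: sigma) (-1) ^+ #|[set v in tau | (v < u)%O]|.

(* Rows are indexed by X(k-1) and columns by X(k).                            *)
Definition boundary (R : rcfType) X (k : nat) :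
    'M[R]_(#|faces X k|, #|faces X k.+1|) :=
  \matrix_(i, j)
    let sigma : {set V} := enum_val i in let tau : {set V} := enum_val j in
    if sigma \subset tau then incidence R tau sigma else 0.

Definition laplacian (R : rcfType) X (k : nat) : 'M[R]_#|faces X k.+1| :=
  boundary R X k.+1 *m (boundary R X k.+1)^T
  + (boundary R X k)^T *m boundary R X k.

(* The set sigma[j].                                                          *)
Definition missing X sigma (j : nat) : {set V} :=
  [set u | [&& [set u] \notin link X sigma,
               [forall v in sigma, [set u] \in link X [set v]] &
               #|[set w in sigma | [set u] \in link X (sigma :\ w)]| == j]].

End SimplicialComplex.

(* Main.v *)
(* Let C be the (k+1)-st additive compound of M = L(G_X) + J, whose           *)
(* eigenvalues are the sums of k+1 eigenvalues of M.  Restricted to chains    *)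
(* supported on X(k), the quadratic form of L_k(X) differs from that of C by  *)
(* a diagonal part and by the entries at pairs of faces sigma, sigma - u + v  *)
(* with uv an edge and sigma + v not a face; bounding the latter by AM-GM and *)
(* counting gives L_k >= C - kn - max.  The theorem follows by min-max: the   *)
(* chains orthogonal to the wedges of eigenvectors with the i - 1 smallest    *)
(* sums have codimension at most i - 1.                                       *)
(* The compound is handled through contraction operators b_i in an            *)
(* orthonormal eigenbasis of M: C = sum_i d_i b_i^T b_i, and                  *)
(* anticommutation gives, for x of degree m and x_s = (b_{s_m} ... b_{s_1} x) *)
(* of degree 0, |x|^2 = sum_s x_s^2 / m! and                                  *)
(* <x, C x> = sum_s (d_{s_1} + ... + d_{s_m}) x_s^2 / m!, with s over         *)
(* m-tuples.                                                                  *)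
Require Import Defs.
From mathcomp Require Import all_boot all_order all_algebra.
From mathcomp Require Import fingroup perm polyrcf complex.
From mathcomp Require Import reals ring lra.

Set Implicit Arguments.
Unset Strict Implicit.
Unset Printing Implicit Defensive.

Import Order.TTheory GRing.Theory Num.Theory.
Local Open Scope ring_scope.

(** In the exterior algebra of R^V the compound form of L(G_X) + J has three pieces: degrees, edges
    and J. The J piece is the squared norm of the contraction by the all-ones vector, which on
    chains of X is exactly the form of the lower part of [laplacian], so these two cancel. What
    remains is compared with the upper part ([laplacian_form_ge]): an off-diagonal pair survives
    only where [u |: eta], [v |: eta] and uv are faces but [u |: (v |: eta)] is not. The diagonal
    cost is settled vertex by vertex ([vertex_count], [face_count]): a vertex costs at most k, plus
    1 if it extends sigma to a larger face, plus j + 1 if it lies in sigma[j]. This is the source of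
    both kn and the weights j + 1. On the spectral side, [eigensum_le_form] bounds the compound form
    below on a subspace of codimension at most i - 1, and [eigenval_ge] turns a form bound on such a
    subspace into a bound on the i-th eigenvalue. *)

(** * Spectral theorem and min-max for real symmetric matrices *)

(** Over the complexification [A] is Hermitian, so it has an eigenvalue, which is real; a real root
    of the characteristic polynomial is already a root over [R]. *)
Lemma symmetric_eigenvector (R : rcfType) (m : nat) (A : 'M[R]_m.+1) :
  A^T = A -> exists a, exists2 v : 'rV_m.+1, v *m A = a *: v & v != 0.
Proof.
move=> A_sym; pose AC := map_mx (real_complex R) A.
have AC_herm : AC \is hermsymmx.
  apply/is_hermitianmxP; rewrite expr0 scale1r; apply/matrixP => i j.
  by rewrite !mxE -{1}A_sym mxE conj_Creal// complex_real.
have /hermitian_normalmx/orthomx_spectralP AC_eq := AC_herm.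
have /mxOverP/(_ ord0 ord0) d_real := hermitian_spectral_diag_real AC_herm.
set d := spectral_diag AC in AC_eq d_real.
set z := d ord0 ord0 in d_real.
have : eigenvalue AC z.
  apply/eigenvalueP; exists (delta_mx 0 0 *m spectralmx AC).
    rewrite {2}AC_eq !mulmxA mulmxK ?spectral_unit// scalemxAl.
    congr (_ *m _); rewrite -rowE; apply/rowP => j; rewrite !mxE eqxx /=.
    by rewrite eq_sym; case: eqP => _; rewrite ?mulr1n ?mulr1 ?mulr0n ?mulr0.
  rewrite -(mul0mx _ (spectralmx AC)).
  rewrite (inj_eq (can_inj (mulmxK (spectral_unit _)))).
  by apply/eqP => /matrixP/(_ 0 0)/eqP; rewrite !mxE !eqxx /= oner_eq0.
have -> : z = real_complex R (complex.Re z) by rewrite RRe_real.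
rewrite eigenvalue_root_char -map_char_poly fmorph_root -eigenvalue_root_char.
by move=> /eigenvalueP[v vA v0]; exists (complex.Re z), v.
Qed.

(* A Householder reflection: if [w = v - e_0] is nonzero then                 *)
(* [1 - 2 w^T w / |w|^2] exchanges [e_0] and [v].                             *)
Lemma orthogonal_completion (R : rcfType) (m : nat) (v : 'rV[R]_m.+1) :
  v *m v^T = 1%:M ->
  exists2 Q : 'M[R]_m.+1, Q *m Q^T = 1%:M & delta_mx 0 0 *m Q = v.
Proof.
move=> v_unit; pose e : 'rV[R]_m.+1 := delta_mx 0 0; pose w := v - e.
have [w0|w_neq0] := eqVneq w 0.
  exists 1%:M; first by rewrite trmx1 mulmx1.
  by rewrite mulmx1; apply/eqP; rewrite eq_sym -subr_eq0; apply/eqP.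
pose c := v 0 0.
have ee : e *m e^T = 1%:M.
  by apply/matrixP => i j; rewrite !ord1 -rowE !mxE !eqxx.
have ev : e *m v^T = c%:M.
  by apply/matrixP => i j; rewrite !ord1 -rowE !mxE eqxx.
have ve : v *m e^T = c%:M by rewrite -[LHS]trmxK trmx_mul trmxK ev tr_scalar_mx.
have ww : w *m w^T = (2 - 2 * c)%:M.
  rewrite /w linearB /= mulmxBr !mulmxBl v_unit ee ev ve -!raddfB /=.
  by congr _%:M; ring.
have ew : e *m w^T = (c - 1)%:M.
  by rewrite /w linearB /= mulmxBr ev ee -raddfB.
have c1 : 2 - 2 * c != 0.
  apply: contraNneq w_neq0 => c0; move: ww; rewrite c0 => /matrixP/(_ 0 0).
  rewrite !mxE mul0rn => /eqP; rewrite psumr_eq0; last first.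
    by move=> i _; rewrite !mxE -expr2 sqr_ge0.
  move=> /allP w0; apply/eqP/rowP => j; rewrite [RHS]mxE; apply/eqP.
  by have := w0 j (mem_index_enum _); rewrite [w^T _ _]mxE mulf_eq0 orbb.
pose s := 2 / (2 - 2 * c).
have sE : s * (2 - 2 * c) = 2 by rewrite /s mulfVK.
pose H := 1%:M - s *: (w^T *m w).
have H_sym : H^T = H.
  by rewrite /H [LHS]linearB /= [(s *: _)^T]linearZ /= trmx1 trmx_mul trmxK.
exists H.
  have wH : w *m H = - w.
    rewrite mulmxBr mulmx1 -scalemxAr mulmxA ww mul_scalar_mx scalerA sE.
    by rewrite scaler_nat mulr2n opprD addrA subrr add0r.
  rewrite H_sym {1}/H mulmxBl mul1mx -scalemxAl -mulmxA wH mulmxN scalerN.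
  by rewrite opprK subrK.
rewrite mulmxBr mulmx1 -scalemxAr mulmxA ew mul_scalar_mx scalerA.
have -> : s * (c - 1) = -1.
  have two_neq0 : 2 != 0 :> R by rewrite pnatr_eq0.
  by apply: (mulfI two_neq0); rewrite mulrN1 -[in RHS]sE; ring.
by rewrite scaleN1r opprK /w addrC subrK.
Qed.

(** Deflation: in an orthonormal basis starting with a unit eigenvector the first row is a multiple
    of e_0, by symmetry so is the first column, and the remaining block is handled by induction. *)
Lemma symmetric_diagonalization (R : rcfType) (m : nat) (A : 'M[R]_m) :
  A^T = A ->
  exists P : 'M_m, exists2 d : 'rV_m, P *m P^T = 1%:M &
    A = P^T *m diag_mx d *m P.
Proof.
elim: m A => [|m IH] A A_sym.
  by exists 1%:M, 0; [rewrite trmx1 mulmx1|apply/matrixP => -[]].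
have [a [v vA v_neq0]] := symmetric_eigenvector A_sym.
pose r := Num.sqrt (\sum_j v 0 j ^+ 2).
have vv : v *m v^T = (r ^+ 2)%:M.
  apply/matrixP => i j; rewrite !ord1 !mxE sqr_sqrtr ?sumr_ge0//; last first.
    by move=> k _; rewrite sqr_ge0.
  by apply: eq_bigr => k _; rewrite !mxE expr2.
have r_neq0 : r != 0.
  apply: contraNneq v_neq0 => r0; move: vv; rewrite r0 => /matrixP/(_ 0 0).
  rewrite !mxE expr0n mul0rn => /eqP; rewrite psumr_eq0; last first.
    by move=> k _; rewrite !mxE -expr2 sqr_ge0.
  move=> /allP v0; apply/eqP/rowP => j; rewrite [RHS]mxE; apply/eqP.
  by have := v0 j (mem_index_enum _); rewrite [v^T _ _]mxE mulf_eq0 orbb.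
have [|Q QQ Qe] := @orthogonal_completion _ _ (r^-1 *: v).
  rewrite linearZ /= -scalemxAl -scalemxAr vv !scale_scalar_mx.
  by congr _%:M; field.
have QQ' : Q^T *m Q = 1%:M by apply: mulmx1C.
pose B : 'M_(1 + m) := Q *m A *m Q^T.
have B_sym : B^T = B by rewrite /B !trmx_mul trmxK A_sym mulmxA.
pose e : 'rV[R]_m.+1 := delta_mx 0 0.
have B_row : e *m B = a *: e.
  have eQA : e *m Q *m A = a *: (e *m Q).
    by rewrite Qe -scalemxAl vA !scalerA mulrC.
  by rewrite /B !mulmxA eQA -scalemxAl -mulmxA QQ mulmx1.
have A_eq : A = Q^T *m B *m Q.
  by rewrite /B !mulmxA QQ' mul1mx -mulmxA QQ' mulmx1.
clearbody B.
have B0 j : B 0 j = a * (j == 0)%:R.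
  by move/rowP/(_ j): B_row; rewrite -rowE !mxE eqxx.
have [P [d PP B_eq]] := IH (drsubmx B) (etrans (trmx_drsub _)
   (congr1 drsubmx B_sym)).
have BE : B = block_mx a%:M 0 0 (P^T *m diag_mx d *m P).
  have l0 : lshift m (0 : 'I_1) = 0 by apply/val_inj.
  have ur : ursubmx B = 0.
    apply/rowP => j; rewrite !mxE -[RHS](mulr0 a).
    by rewrite l0 B0.
  rewrite -[B]submxK -B_eq ur -[dlsubmx B]trmxK trmx_dlsub B_sym ur trmx0.
  congr block_mx; apply/matrixP => i j; rewrite !ord1 !mxE.
  by rewrite l0 B0 mulr1.
pose P1 : 'M[R]_(1 + m) := block_mx 1%:M 0 0 P.
pose D : 'rV[R]_(1 + m) := row_mx a%:M d.
have PP1 : P1 *m P1^T = 1%:M.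
  rewrite tr_block_mx !trmx0 trmx1.
  rewrite mulmx_block !mulmx0 !mul0mx !mulmx1 !addr0 add0r PP.
  by rewrite -scalar_mx_block.
have PDP1 : B = P1^T *m diag_mx D *m P1.
  rewrite BE diag_mx_row tr_block_mx !trmx0 trmx1.
  rewrite !mulmx_block !mulmx0 !mul0mx !mulmx1 !addr0 !mul0mx !add0r mul1mx.
  by congr block_mx; apply/matrixP => i j; rewrite !ord1 !mxE eqxx.
exists (P1 *m (Q : 'M_(1 + m))), D.
  by rewrite trmx_mul -mulmxA (mulmxA (Q : 'M_(1 + m))) QQ mul1mx.
by rewrite A_eq PDP1 trmx_mul !mulmxA.
Qed.

Lemma mem_rootsR (R : rcfType) (p : {poly R}) x :
  p != 0 -> (x \in rootsR p) = root p x.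
Proof. by move=> p_neq0; rewrite -(roots_on_rootsR p_neq0). Qed.

Lemma mup_prod_XsubC (R : rcfType) (I : Type) (r : seq I) (f : I -> R) x :
  mup x (\prod_(i <- r) ('X - (f i)%:P)) = count_mem x [seq f i | i <- r].
Proof.
elim: r => [|i r IH]; first by rewrite big_nil mupNroot ?root1.
rewrite big_cons mupM ?polyXsubC_eq0 ?monic_neq0 ?monic_prod_XsubC// IH /=.
by rewrite -['X - _]expr1 mup_XsubCX; case: eqP.
Qed.

Lemma sorted_spectrum (R : rcfType) m (M : 'M[R]_m) : sorted <=%R (spectrum M).
Proof.
rewrite /spectrum; have := sorted_roots (- cauchy_bound (char_poly M))
  (cauchy_bound (char_poly M)) (char_poly M).
rewrite -/(rootsR _) (sorted_pairwise lt_trans) (sorted_pairwise le_trans).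
elim: (rootsR _) => //= x s IH /andP[/allP x_lt /IH s_sorted].
rewrite pairwise_cat s_sorted andbT; apply/andP; split; last first.
  by elim: (mup _ _) => //= k ->; rewrite andbT; apply/allP => y /nseqP[->].
apply/allrelP => y z /nseqP[-> _] /flattenP[t /mapP[w ws ->] /nseqP[-> _]].
exact/ltW/x_lt.
Qed.

Lemma char_poly_conj_diag (R : rcfType) m (P : 'M[R]_m) (d : 'rV_m) :
  P *m P^T = 1%:M ->
  char_poly (P^T *m diag_mx d *m P) = \prod_i ('X - (d 0 i)%:P).
Proof.
move=> PP; pose f (N : 'M[R]_m) : 'M[{poly R}]_m := map_mx polyC N.
have fPP : f P^T *m f P = 1%:M by rewrite -map_mxM (mulmx1C PP) map_mx1.
transitivity (char_poly (diag_mx d)); last first.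
  rewrite char_poly_trig ?diag_mx_is_trig//.
  by apply: eq_bigr => i _; rewrite mxE eqxx mulr1n.
rewrite /char_poly /char_poly_mx -/f.
have -> : 'X%:M - f (P^T *m diag_mx d *m P)
        = f P^T *m ('X%:M - f (diag_mx d)) *m f P.
  rewrite mulmxBr mulmxBl mul_mx_scalar -scalemxAl fPP scalemx1.
  by rewrite /f !map_mxM.
by rewrite !det_mulmx mulrAC -det_mulmx fPP det1 mul1r.
Qed.

Lemma perm_spectrum (R : rcfType) m (P : 'M[R]_m) (d : 'rV_m) :
  P *m P^T = 1%:M ->
  perm_eq (spectrum (P^T *m diag_mx d *m P)) [tuple d 0 i | i < m].
Proof.
move=> PP; set M := P^T *m _ *m _.
have M_neq0 : char_poly M != 0 by rewrite monic_neq0 ?char_poly_monic.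
have uniq_roots : uniq (rootsR (char_poly M)).
  by apply: (sorted_uniq lt_trans ltxx); apply: sorted_roots.
rewrite /perm_eq; apply/allP => x _ /=; apply/eqP.
have -> : count_mem x [tuple d 0 i | i < m] = mup x (char_poly M).
  by rewrite char_poly_conj_diag// -big_enum mup_prod_XsubC.
rewrite /spectrum count_flatten -map_comp sumnE big_map.
rewrite (eq_bigr (fun y => (y == x) * mup x (char_poly M))%N); last first.
  by move=> y _ /=; rewrite count_nseq /=; case: eqP => [->|].
rewrite -big_distrl /=.
have -> : (\sum_(y <- rootsR (char_poly M)) (y == x) =
           count_mem x (rootsR (char_poly M)))%N.
  rewrite -sum1_count [RHS]big_mkcond; apply: eq_bigr => y _ /=.
  by case: (y == x).
rewrite count_uniq_mem// mem_rootsR//.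
by have [|/mupNroot ->] := boolP (root _ x); rewrite ?mul1n ?muln0.
Qed.

(** The entries of any diagonalization are a permutation of [spectrum A]; permuting the rows of [P]
    accordingly sorts the eigenbasis. *)
Lemma symmetric_spectral (R : rcfType) m (A : 'M[R]_m) :
  A^T = A -> exists2 P : 'M_m, P *m P^T = 1%:M &
    A = P^T *m diag_mx (\row_j eigenval A j.+1) *m P.
Proof.
move=> /symmetric_diagonalization[P [d PP A_eq]].
have /tuple_permP[p sp] := perm_spectrum d PP; rewrite -A_eq in sp.
have eigE (j : 'I_m) : eigenval A j.+1 = d 0 (p j).
  by rewrite /eigenval /= sp -tnth_nth !tnth_mktuple.
exists (row_perm p P).
  rewrite row_permE trmx_mul mulmxA -[_ *m P *m _]mulmxA PP mulmx1 tr_perm_mx.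
  by rewrite -perm_mxM mulgV perm_mx1.
set e := \row_j _.
have e_eq : diag_mx d = perm_mx p^-1 *m diag_mx e *m perm_mx p.
  rewrite -{2}[p]invgK -col_permE -row_permE; apply/matrixP => i j.
  by rewrite !mxE eigE permKV (inj_eq perm_inj).
by rewrite row_permE trmx_mul tr_perm_mx {1}A_eq e_eq !mulmxA.
Qed.

(** Half of Courant-Fischer: the span of the first i eigenvectors meets the kernel of [B], of
    codimension at most r < i, and on that span the form is at most the i-th eigenvalue times the
    squared norm. *)
Lemma eigenval_ge (R : rcfType) m r (A : 'M[R]_m) (B : 'M_(m, r)) (mu : R)
    (i : nat) :
  A^T = A -> (r < i)%N -> (i <= m)%N ->
  (forall x : 'rV_m, x *m B = 0 ->
    mu * (\sum_j x 0 j ^+ 2) <= (x *m A *m x^T) 0 0) ->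
  mu <= eigenval A i.
Proof.
move=> A_sym ri im le_mu.
have [P PP A_eq] := symmetric_spectral A_sym.
(* The rows of [U *m P] are the eigenvectors of the i smallest eigenvalues. *)
pose U : 'M[R]_(i, m) := pid_mx i.
have [c cB c_neq0] : exists2 c : 'rV_i, c *m (U *m P *m B) = 0 & c != 0.
  have : kermx (U *m P *m B) != 0.
    rewrite kermx_eq0 -row_leq_rank -ltnNge.
    exact: leq_ltn_trans (rank_leq_col _) ri.
  by move=> /rowV0Pn[c /sub_kermxP cB c0]; exists c.
pose y := c *m U.
have yE (a : 'I_i) : y 0 (widen_ord im a) = c 0 a.
  rewrite mxE (bigD1 a)//= mxE eqxx ltn_ord mulr1 big1 ?addr0// => b /negPf ba.
  by rewrite mxE val_eqE ba mulr0.
have y0 (j : 'I_m) : (i <= j)%N -> y 0 j = 0.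
  move=> ij; rewrite mxE big1// => a _; rewrite mxE /= ltn_eqF ?mulr0//.
  exact: leq_trans (ltn_ord a) ij.
have sum_sq (z : 'rV[R]_m) : (z *m z^T) 0 0 = \sum_j z 0 j ^+ 2.
  by rewrite mxE; apply: eq_bigr => j _; rewrite mxE.
have := le_mu (y *m P).
rewrite /y -!mulmxA !(mulmxA U) cB => /(_ erefl); rewrite !mulmxA -/y.
set lam := \row_j _ in A_eq.
have -> : \sum_j (y *m P) 0 j ^+ 2 = \sum_j y 0 j ^+ 2.
  by rewrite -!sum_sq trmx_mul mulmxA -(mulmxA y) PP mulmx1.
have -> : y *m P *m A *m (y *m P)^T = y *m diag_mx lam *m y^T.
  rewrite trmx_mul {1}A_eq !mulmxA -(mulmxA y P) PP mulmx1.
  by rewrite -(mulmxA _ P P^T) PP mulmx1.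
have -> : (y *m diag_mx lam *m y^T) 0 0 = \sum_j lam 0 j * y 0 j ^+ 2.
  by rewrite mul_mx_diag mxE; apply: eq_bigr => j _; rewrite !mxE; ring.
move=> le_sum.
have : mu * \sum_j y 0 j ^+ 2 <= eigenval A i * \sum_j y 0 j ^+ 2.
  apply: (le_trans le_sum); rewrite mulr_sumr; apply: ler_sum => j _.
  have [ij|ji] := leqP i j; first by rewrite (y0 _ ij) expr0n !mulr0.
  rewrite ler_wpM2r ?sqr_ge0// mxE /eigenval.
  have i_gt0 : (0 < i)%N by apply: leq_ltn_trans ji.
  have sz : size (spectrum A) = m.
    by rewrite A_eq (perm_size (perm_spectrum _ PP)) size_tuple.
  apply: (sorted_leq_nth le_trans le_refl 0 (sorted_spectrum A)).
  - by rewrite inE sz /= ltn_ord.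
  - by rewrite inE sz prednK.
  - by rewrite /= -ltnS prednK.
rewrite ler_pM2r// lt_neqAle sumr_ge0 ?andbT; last first.
  by move=> j _; apply: sqr_ge0.
apply: contraNneq c_neq0 => /esym/eqP; rewrite psumr_eq0; last first.
  by move=> j _; apply: sqr_ge0.
move=> /allP z0; apply/eqP/rowP => a; rewrite -yE [RHS]mxE; apply/eqP.
by have := z0 (widen_ord im a) (mem_index_enum _); rewrite /= sqrf_eq0.
Qed.

(** * Contractions on the exterior algebra and additive compounds *)

Lemma sum_tuple_cons (R : nmodType) (I : finType) (m : nat) (F : seq I -> R) :
  \sum_(s : m.+1.-tuple I) F s = \sum_i \sum_(s : m.-tuple I) F (i :: s).
Proof.
rewrite pair_big /= (reindex (fun p : I * m.-tuple I => [tuple of p.1 :: p.2])).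
  by apply: eq_bigr => -[].
exists (fun s : m.+1.-tuple I => (thead s, [tuple of behead s])).
  move=> [i s] _.
  by rewrite /= theadE; congr pair; apply/val_inj.
by move=> s _; rewrite [RHS]tuple_eta.
Qed.

Section Fock.
Variables (R : rcfType) (d : Order.disp_t) (V : finOrderType d).
Implicit Types (x y : {ffun {set V} -> R}) (eta sigma : {set V}) (u v w : V).

Definition vsign u eta : R := (-1) ^+ #|[set v in eta | (v < u)%O]|.

Lemma vsign_sqr u eta : vsign u eta ^+ 2 = 1.
Proof. exact: sqrr_sign. Qed.

Lemma vsign_self u eta : vsign u (u |: eta) = vsign u eta.
Proof.
congr (_ ^+ #|pred_of_set _|); apply/setP => v; rewrite !inE.
by case: eqVneq => //= ->; rewrite ltxx !andbF.
Qed.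

Lemma vsignU1 u v eta : v \notin eta ->
  vsign u (v |: eta) = (-1) ^+ (v < u)%O * vsign u eta.
Proof.
move=> v_eta; rewrite /vsign; have [vu|vu] := boolP (v < u)%O; last first.
  rewrite mul1r; congr (_ ^+ #|pred_of_set _|); apply/setP => w; rewrite !inE.
  by case: eqVneq => //= ->; rewrite (negPf vu) andbF.
rewrite -exprD; congr (_ ^+ _).
have -> : [set w in v |: eta | (w < u)%O] = v |: [set w in eta | (w < u)%O].
  apply/setP => w; rewrite !inE.
  by case: eqVneq => //= ->; rewrite vu.
by rewrite cardsU1 !inE (negPf v_eta).
Qed.

(** Exactly one of u, v precedes the other, so adding each to the set flips exactly one of the two
    signs. *)
Lemma vsign_anticomm u v eta : u != v -> u \notin eta -> v \notin eta ->
  vsign u eta * vsign v (u |: eta) = - (vsign v eta * vsign u (v |: eta)).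
Proof.
move=> uv u_eta v_eta; rewrite !vsignU1//.
have [lt_uv|lt_vu|eq_uv] := ltgtP u v; last by rewrite eq_uv eqxx in uv.
- by rewrite mul1r expr1 mulN1r; ring.
- by rewrite mul1r expr1 mulN1r; ring.
Qed.

Lemma vsign_swap u v eta : u != v -> u \notin eta -> v \notin eta ->
  vsign u (v |: eta) * vsign v (u |: eta) = - (vsign u eta * vsign v eta).
Proof.
move=> uv u_eta v_eta; rewrite !vsignU1//.
have [lt_uv|lt_vu|eq_uv] := ltgtP u v; last by rewrite eq_uv eqxx in uv.
- by rewrite mul1r expr1 mulN1r mulrN.
- by rewrite mul1r expr1 mulN1r mulNr.
Qed.

(** Pairs of nested sets differing in one vertex u, indexed by the smaller or by the larger set. *)
Lemma sum_setU1_setD1 (F : V -> {set V} -> R) :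
  \sum_(eta : {set V}) \sum_(u | u \notin eta) F u eta =
  \sum_(sigma : {set V}) \sum_(u in sigma) F u (sigma :\ u).
Proof.
rewrite (exchange_big_dep xpredT)//= [RHS](exchange_big_dep xpredT)//=.
apply: eq_bigr => u _.
rewrite (reindex_onto (fun sigma => sigma :\ u) (fun eta => u |: eta)) /=.
  apply: eq_bigl => sigma; rewrite !inE eqxx /=.
  by apply/eqP/idP => [<-|/setD1K//]; rewrite !inE eqxx.
by move=> eta u_eta; rewrite setU1K.
Qed.

(* Functions on the subsets of V form the exterior algebra of R^V, and        *)
(* [annih u] is the contraction with the basis vector u.                      *)
Definition annih u x : {ffun {set V} -> R} :=
  [ffun eta : {set V} => if u \in eta then 0 else vsign u eta * x (u |: eta)].

Lemma annih_anticomm u v x eta :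
  annih u (annih v x) eta = - annih v (annih u x) eta.
Proof.
rewrite !ffunE !inE; have [->|uv] := eqVneq u v.
  by rewrite mulr0 if_same oppr0.
rewrite /=.
have [u_eta|u_eta] := boolP (u \in eta); first by rewrite mulr0 if_same oppr0.
have [v_eta|v_eta] := boolP (v \in eta); first by rewrite mulr0 oppr0.
by rewrite !mulrA vsign_anticomm// mulNr setUCA.
Qed.

Lemma annih_sqr u x eta :
  annih u x eta ^+ 2 = if u \in eta then 0 else x (u |: eta) ^+ 2.
Proof.
rewrite ffunE; case: ifP => _; first by rewrite expr0n.
by rewrite exprMn vsign_sqr mul1r.
Qed.

Definition sqnorm x : R := \sum_eta x eta ^+ 2.

(** Membership in the m-th exterior power of R^V. *)
Definition homogeneous m x := forall eta, #|eta| != m -> x eta = 0.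

Lemma sum_annih_sqr (c : V -> {set V} -> R) x :
  \sum_eta \sum_u c u eta * annih u x eta ^+ 2 =
  \sum_(sigma : {set V}) (\sum_(u in sigma) c u (sigma :\ u)) * x sigma ^+ 2.
Proof.
transitivity
  (\sum_(eta : {set V}) \sum_(u | u \notin eta) c u eta * x (u |: eta) ^+ 2).
  apply: eq_bigr => eta _; rewrite [RHS]big_mkcond; apply: eq_bigr => u _.
  by rewrite annih_sqr; case: ifP; rewrite ?mulr0.
rewrite (sum_setU1_setD1 (fun u eta => c u eta * x (u |: eta) ^+ 2)).
apply: eq_bigr => sigma _; rewrite mulr_suml.
by apply: eq_bigr => u u_sigma; rewrite setD1K.
Qed.

(** Contraction with the vector [p] of R^V. *)
Definition annihs (p : V -> R) x : {ffun {set V} -> R} :=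
  [ffun eta => \sum_u p u * annih u x eta].

Lemma annihs_anticomm p q x : annihs p (annihs q x) = - annihs q (annihs p x).
Proof.
have annih_annihs p' q' : forall eta, annihs p' (annihs q' x) eta =
    \sum_u \sum_v p' u * (q' v * annih u (annih v x) eta).
  move=> eta; rewrite ffunE; apply: eq_bigr => u _; rewrite -mulr_sumr.
  congr (_ * _); rewrite ffunE; case: ifP => u_eta.
    by rewrite big1// => v _; rewrite ffunE u_eta mulr0.
  rewrite ffunE mulr_sumr; apply: eq_bigr => v _.
  by rewrite [annih u _ _]ffunE u_eta; ring.
apply/ffunP => eta; rewrite [RHS]ffunE !annih_annihs exchange_big -sumrN.
apply: eq_bigr => v _; rewrite -sumrN; apply: eq_bigr => u _.
by rewrite annih_anticomm; ring.
Qed.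

Lemma annihsN p x : annihs p (- x) = - annihs p x.
Proof.
apply/ffunP => eta; rewrite !ffunE -sumrN; apply: eq_bigr => u _.
by rewrite !ffunE; case: ifP => _; ring.
Qed.

Lemma annihs_homogeneous p m x :
  homogeneous m.+1 x -> homogeneous m (annihs p x).
Proof.
move=> x_hom eta eta_m; rewrite ffunE big1// => u _; rewrite ffunE.
case: ifPn => u_eta; first by rewrite mulr0.
by rewrite x_hom ?mulr0// cardsU1 u_eta eqSS.
Qed.

Lemma sqnormN x : sqnorm (- x) = sqnorm x.
Proof. by apply: eq_bigr => eta _; rewrite ffunE sqrrN. Qed.

Lemma sqnorm_homogeneous0 x : homogeneous 0 x -> sqnorm x = x set0 ^+ 2.
Proof.
move=> x_hom; rewrite /sqnorm (bigD1 set0)//= big1 ?addr0// => eta eta0.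
by rewrite x_hom ?expr0n// cards_eq0.
Qed.

(* The quadratic form of the second quantization of [M], i.e. of its additive *)
(* compounds of all orders.                                                   *)
Definition compound_form (M : V -> V -> R) x : R :=
  \sum_eta \sum_u \sum_v M u v * (annih u x eta * annih v x eta).

(** Writing a matrix as a combination of rank-one matrices writes its compound form as the same
    combination of squared contractions. *)
Lemma sum_sqnorm_annihs (I : finType) (D : I -> R) (P : I -> V -> R) x :
  \sum_i D i * sqnorm (annihs (P i) x) =
  compound_form (fun u v => \sum_i D i * (P i u * P i v)) x.
Proof.
rewrite /sqnorm; under eq_bigr do rewrite mulr_sumr.
rewrite exchange_big; apply: eq_bigr => eta _ /=.
transitivity (\sum_i \sum_u \sum_v
    (D i * (P i u * P i v)) * (annih u x eta * annih v x eta)).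
  apply: eq_bigr => i _; rewrite ffunE expr2 mulr_suml mulr_sumr.
  apply: eq_bigr => u _; rewrite mulr_sumr mulr_sumr.
  by apply: eq_bigr => v _; ring.
rewrite exchange_big; apply: eq_bigr => u _.
rewrite exchange_big; apply: eq_bigr => v _.
by rewrite mulr_suml.
Qed.

Lemma compound_form_id m x : homogeneous m x ->
  compound_form (fun u v => (u == v)%:R) x = m%:R * sqnorm x.
Proof.
move=> x_hom; rewrite /compound_form.
transitivity (\sum_eta \sum_u 1 * annih u x eta ^+ 2).
  apply: eq_bigr => eta _; apply: eq_bigr => u _.
  rewrite (bigD1 u)//= eqxx big1 ?addr0; first by rewrite expr2.
  by move=> v /negPf vu; rewrite eq_sym vu mul0r.
rewrite (sum_annih_sqr (fun _ _ => 1)) mulr_sumr; apply: eq_bigr => sigma _.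
have [sigma_m|/x_hom ->] := eqVneq #|sigma| m; last by rewrite expr0n !mulr0.
by rewrite sumr_const sigma_m.
Qed.

(** * Wedge coordinates in an orthonormal basis *)

Section OrthonormalFamily.
Variables (I : finType) (P : I -> V -> R).
Hypothesis P_orth : forall u v, \sum_i P i u * P i v = (u == v)%:R.
Variable D : I -> R.

Local Notation b i := (annihs (P i)).
Local Notation Q x := (\sum_i D i * sqnorm (b i x)).

(* The coordinate of [x] on the wedge of the vectors [P i], for [i] in [s].   *)
Definition wedge_coord (s : seq I) x : R :=
  foldl (fun y i => b i y) x s set0.

Lemma wedge_coordN s x : wedge_coord s (- x) = - wedge_coord s x.
Proof.
rewrite /wedge_coord; elim: s x => [|i s IH] x /=; first by rewrite ffunE.
by rewrite annihsN IH.
Qed.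

Lemma wedge_coord_sqrN s x : wedge_coord s (- x) ^+ 2 = wedge_coord s x ^+ 2.
Proof. by rewrite wedge_coordN sqrrN. Qed.

(** Anticommutation brings i to the front at the cost of a sign, which squaring removes. *)
Lemma wedge_coord_cat_cons s t i x :
  wedge_coord (s ++ i :: t) x ^+ 2 = wedge_coord (i :: s ++ t) x ^+ 2.
Proof.
elim: s x => //= j s IH x; rewrite -!/(wedge_coord (_ :: _) _).
rewrite [LHS](IH (b j x)) /wedge_coord /= annihs_anticomm.
exact: wedge_coord_sqrN.
Qed.

Lemma wedge_coord_perm s t x :
  perm_eq s t -> wedge_coord s x ^+ 2 = wedge_coord t x ^+ 2.
Proof.
elim: s t x => [|i s IH] t x; first by rewrite perm_sym => /perm_nilP ->.
move=> st; have it : i \in t by rewrite -(perm_mem st) mem_head.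
move: st; case/splitPr: it => t1 t2; rewrite perm_sym perm_catC /= perm_cons.
rewrite perm_catC perm_sym => st; rewrite wedge_coord_cat_cons.
exact: (IH _ (b i x)).
Qed.

(** A repeated index can be moved next to its copy, and a contraction anticommuting with itself
    squares to zero. *)
Lemma wedge_coord_uniq s x : wedge_coord s x != 0 -> uniq s.
Proof.
apply: contraNT => s_nuniq; rewrite -sqrf_eq0.
have bb0 i y : b i (b i y) = 0.
  apply/ffunP => eta; move/ffunP/(_ eta): (annihs_anticomm (P i) (P i) y).
  by rewrite [RHS]ffunE [in X in _ -> X = _]/= => h; rewrite [RHS]ffunE; lra.
have w0 t : wedge_coord t 0 = 0.
  by have := wedge_coordN t 0; rewrite oppr0; lra.
elim: s x s_nuniq => //= i s IH x; rewrite negb_and negbK.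
case/orP => [si|s_nuniq]; last exact: (IH (b i x)).
case/splitPr: si => s1 s2; rewrite -/(wedge_coord (i :: _) x).
rewrite (wedge_coord_cat_cons (i :: s1)) /wedge_coord /= bb0.
by rewrite -/(wedge_coord _ _) w0 expr0n.
Qed.

Lemma sum_sqnorm_orthonormal m x : homogeneous m x ->
  \sum_i sqnorm (b i x) = m%:R * sqnorm x.
Proof.
move=> x_hom; rewrite -(compound_form_id x_hom).
rewrite (eq_bigr (fun i => 1 * sqnorm (b i x))) => [|i _]; last first.
  by rewrite mul1r.
rewrite sum_sqnorm_annihs; apply: eq_bigr => eta _; apply: eq_bigr => u _.
apply: eq_bigr => v _; congr (_ * _); rewrite -P_orth.
by apply: eq_bigr => i _; rewrite mul1r.
Qed.

Lemma sum_wedge_coord m x : homogeneous m x ->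
  \sum_(s : m.-tuple I) wedge_coord s x ^+ 2 = m`!%:R * sqnorm x.
Proof.
elim: m x => [|m IH] x x_hom.
  rewrite (big_pred1 [tuple]) => [|s]; last by rewrite [s]tuple0 /= eqxx.
  by rewrite sqnorm_homogeneous0// mul1r.
rewrite (sum_tuple_cons _ (fun s => wedge_coord s x ^+ 2)).
transitivity (\sum_i m`!%:R * sqnorm (b i x)).
  by apply: eq_bigr => i _; rewrite -IH//; apply: annihs_homogeneous.
by rewrite -mulr_sumr (sum_sqnorm_orthonormal x_hom) mulrA -natrM mulnC -factS.
Qed.

(** Split off the first index i: it carries the weight [D i], and the other weights give, by
    induction, the form at [b i x]. *)
Lemma sum_wedge_coord_weighted m x : homogeneous m x ->
  \sum_(s : m.-tuple I) (\sum_(j <- s) D j) * wedge_coord s x ^+ 2 =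
  m`!%:R * Q x.
Proof.
elim: m x => [|m IH] x x_hom.
  rewrite (big_pred1 [tuple]) => [|s]; last by rewrite [s]tuple0 /= eqxx.
  rewrite big_nil mul0r mul1r big1// => i _.
  rewrite /sqnorm big1 ?mulr0// => eta _; rewrite ffunE big1 ?expr0n// => u _.
  rewrite ffunE; case: ifPn => u_eta; first by rewrite mulr0.
  by rewrite x_hom ?mulr0// cardsU1 u_eta.
rewrite (sum_tuple_cons _
  (fun s => (\sum_(j <- s) D j) * wedge_coord s x ^+ 2)).
have b_hom i : homogeneous m (b i x) by apply: annihs_homogeneous.
transitivity (\sum_i (D i * (m`!%:R * sqnorm (b i x)) + m`!%:R * Q (b i x))).
  apply: eq_bigr => i _; rewrite -sum_wedge_coord// -IH// mulr_sumr -big_split.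
  by apply: eq_bigr => s _; rewrite big_cons mulrDl.
(* After anticommuting [b i] past [b j], the sum over i counts the degree m of [b j x]. *)
have Qb : \sum_i Q (b i x) = m%:R * Q x.
  rewrite exchange_big mulr_sumr; apply: eq_bigr => j _ /=.
  rewrite mulrCA -(sum_sqnorm_orthonormal (b_hom j)) mulr_sumr.
  by apply: eq_bigr => i _; rewrite annihs_anticomm sqnormN.
rewrite big_split /= -mulr_sumr Qb factS natrM -natr1.
rewrite (eq_bigr (fun i => m`!%:R * (D i * sqnorm (b i x)))) => [|i _].
  by rewrite -mulr_sumr; ring.
by rewrite mulrCA.
Qed.

Lemma weighted_sqnorm_ge m x mu : homogeneous m x ->
  (forall s : m.-tuple I, wedge_coord s x != 0 -> mu <= \sum_(j <- s) D j) ->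
  mu * sqnorm x <= Q x.
Proof.
move=> x_hom mu_le; have fact_gt0' : 0 < m`!%:R :> R by rewrite ltr0n fact_gt0.
rewrite -(ler_pM2l fact_gt0') -sum_wedge_coord_weighted// mulrCA.
rewrite -sum_wedge_coord// mulr_sumr; apply: ler_sum => s _.
have [->|s_neq0] := eqVneq (wedge_coord s x) 0; first by rewrite expr0n !mulr0.
by rewrite ler_wpM2r ?sqr_ge0// mu_le.
Qed.

(** The vanishing of one coordinate thus costs at most one dimension. *)
Lemma wedge_coord_linear (s : seq I) :
  exists G : {set V} -> R,
    forall x, wedge_coord s x = \sum_sigma G sigma * x sigma.
Proof.
elim: s => [|i s [G GP]].
  exists (fun sigma => (sigma == set0)%:R) => x; rewrite (bigD1 set0)//= eqxx.
  by rewrite mul1r big1 ?addr0// => sigma /negPf ->; rewrite mul0r.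
exists (fun sigma => \sum_(u in sigma)
   G (sigma :\ u) * P i u * vsign u (sigma :\ u)) => x.
rewrite /wedge_coord /= -/(wedge_coord s _) GP.
transitivity (\sum_(eta : {set V}) \sum_(u | u \notin eta)
    G eta * P i u * vsign u eta * x (u |: eta)).
  apply: eq_bigr => eta _; rewrite ffunE mulr_sumr [RHS]big_mkcond.
  apply: eq_bigr => u _; rewrite ffunE; case: ifP => _; first by rewrite !mulr0.
  by rewrite !mulrA.
rewrite (sum_setU1_setD1
  (fun u eta => G eta * P i u * vsign u eta * x (u |: eta))).
apply: eq_bigr => sigma _; rewrite mulr_suml.
by apply: eq_bigr => u u_sigma; rewrite setD1K.
Qed.

End OrthonormalFamily.

(* [compound_form] is at least [eigensum M k i] on a subspace of codimension  *)
(* at most [i - 1]: the vectors whose coordinates on the wedges of            *)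
(* eigenvectors with the [i - 1] smallest eigenvalue sums vanish.             *)
Lemma eigensum_le_form (M : 'M[R]_#|V|) (k i : nat) : M^T = M ->
  exists G : 'I_i.-1 -> {set V} -> R, forall x, homogeneous k x ->
    (forall j, \sum_sigma G j sigma * x sigma = 0) ->
  eigensum M k i * sqnorm x <=
    compound_form (fun u v => M (enum_rank u) (enum_rank v)) x.
Proof.
move=> M_sym; have [P PP M_eq] := symmetric_spectral M_sym.
pose p (a : 'I_#|V|) u := P a (enum_rank u).
pose D (a : 'I_#|V|) := eigenval M a.+1.
have p_orth u v : \sum_a p a u * p a v = (u == v)%:R.
  have /matrixP/(_ (enum_rank u) (enum_rank v)) := mulmx1C PP.
  rewrite !mxE (inj_eq enum_rank_inj) => <-.
  by apply: eq_bigr => a _; rewrite mxE.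
pose F (A : {set 'I_#|V|}) := \sum_(j in A) D j.
pose leF := relpre F <=%R.
pose As := sort leF (enum [set A : {set 'I_#|V|} | #|A| == k]).
have eigensumE : eigensum M k i = nth 0 (map F As) i.-1.
  by rewrite /eigensum sort_map.
have As_sorted : sorted <=%R (map F As).
  by rewrite /As -sort_map; apply/sort_sorted/le_total.
(* If there are fewer than i - 1 index sets, the default [set0] merely imposes extra conditions on
   x. *)
have [G GP] : exists G : 'I_i.-1 -> {set V} -> R, forall (j : 'I_i.-1) x,
    wedge_coord p (enum (nth set0 As j)) x = \sum_sigma G j sigma * x sigma.
  have linear_coord (j : 'I_i.-1) :=
    wedge_coord_linear p (enum (nth set0 As j)).
  exact: (fin_all_exists linear_coord).
exists G => x x_hom x_G.
have -> : compound_form (fun u v => M (enum_rank u) (enum_rank v)) x =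
    \sum_a D a * sqnorm (annihs (p a) x).
  rewrite sum_sqnorm_annihs; apply: eq_bigr => eta _.
  apply: eq_bigr => u _; apply: eq_bigr => v _; congr (_ * _).
  rewrite {1}M_eq mul_mx_diag !mxE; apply: eq_bigr => a _.
  by rewrite !mxE /p /D; ring.
apply: (weighted_sqnorm_ge p_orth x_hom) => s s_neq0.
have s_uniq := wedge_coord_uniq s_neq0.
pose A := [set a in s].
have A_enum : perm_eq s (enum A).
  apply: uniq_perm => //; first exact: enum_uniq.
  by move=> a; rewrite mem_enum inE.
have A_As : A \in As.
  by rewrite mem_sort mem_enum inE cardE -(perm_size A_enum) size_tuple.
have FA : F A = \sum_(j <- s) D j.
  by rewrite /F -big_enum; apply: perm_big; rewrite perm_sym.
rewrite -FA eigensumE -[A](nth_index set0 A_As).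
have index_lt : (index A As < size As)%N by rewrite index_mem.
(* If [A] is among the first i - 1 sets, its coordinate vanishes by the choice of [G], contradicting
   [s_neq0]; otherwise its sum is at least the i-th smallest. *)
have [index_small|le_index] := ltnP (index A As) i.-1.
  have := x_G (Ordinal index_small); rewrite -GP /= nth_index// => A0.
  move: s_neq0; rewrite -sqrf_eq0 (wedge_coord_perm _ _ A_enum) A0.
  by rewrite expr0n eqxx.
rewrite -(nth_map _ 0)//.
apply: (sorted_leq_nth le_trans le_refl 0 As_sorted) => //.
  by rewrite inE size_map (leq_ltn_trans le_index).
by rewrite inE size_map.
Qed.

End Fock.

(** * Boundary maps in terms of contractions *)

Section Incidence.
Variables (R : rcfType) (d : Order.disp_t) (V : finOrderType d).
Implicit Types (x y : {ffun {set V} -> R}) (eta sigma tau : {set V}).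
Implicit Types (u v w : V) (X : {set {set V}}).

Lemma sum_incidence_sub m y tau : homogeneous m y -> #|tau| = m.+1 ->
  \sum_sigma y sigma * (if sigma \subset tau then incidence R tau sigma else 0)
  = \sum_(u in tau) vsign R u tau * y (tau :\ u).
Proof.
move=> y_hom tau_card.
transitivity (\sum_(sigma : {set V}) \sum_(u in tau)
   (if (sigma \subset tau) && (u \notin sigma)
    then vsign R u tau * y sigma else 0)).
  apply: eq_bigr => sigma _; case: ifP => sub /=; last by rewrite mulr0 big1.
  rewrite -big_mkcondr /= mulr_sumr.
  by apply: eq_big => u; [rewrite inE andbC | rewrite mulrC].
rewrite exchange_big; apply: eq_bigr => u u_tau /=.
rewrite (bigD1 (tau :\ u))//= subD1set !inE eqxx /=.
rewrite big1 ?addr0// => sigma sigma_neq.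
case: ifP => // /andP[sub u_sigma].
rewrite y_hom ?mulr0//; apply: contra_neq sigma_neq => sigma_m.
apply/eqP; rewrite eqEcard subsetD1 sub u_sigma /= sigma_m.
by rewrite -ltnS -tau_card (cardsD1 u tau) u_tau.
Qed.

(** The boundary map is the contraction by the all-ones vector; this is why J appears in the
    theorem. *)
Lemma sum_incidence_sup m y eta : homogeneous m.+1 y -> #|eta| = m ->
  \sum_sigma y sigma * (if eta \subset sigma then incidence R sigma eta else 0)
  = \sum_u annih u y eta.
Proof.
move=> y_hom eta_card.
transitivity (\sum_(sigma : {set V}) \sum_u
   (if [&& eta \subset sigma, u \in sigma & u \notin eta]
    then vsign R u sigma * y sigma else 0)).
  apply: eq_bigr => sigma _; case: ifP => sub /=; last by rewrite mulr0 big1.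
  rewrite -big_mkcond /= mulr_sumr.
  by apply: eq_big => u; [rewrite inE andbC | rewrite mulrC].
rewrite exchange_big; apply: eq_bigr => u _ /=; rewrite ffunE.
have [u_eta|u_eta] := boolP (u \in eta).
  by rewrite big1// => sigma _; rewrite !andbF.
rewrite (bigD1 (u |: eta))//= subsetU1 setU11 /= vsign_self.
rewrite big1 ?addr0// => sigma sigma_neq.
case: ifP => // /and3P[sub u_sigma _].
rewrite y_hom ?mulr0//; apply: contra_neq sigma_neq => sigma_m.
apply/esym/eqP; rewrite eqEcard subUset sub1set u_sigma sub /=.
by rewrite sigma_m cardsU1 u_eta eta_card.
Qed.

(* The canonical anticommutation relations: up to its diagonal part, the      *)
(* up-Laplacian is minus a sum over pairs of codimension-one cofaces.         *)
Lemma sum_coboundary_sqr (T : {set {set V}}) y :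
  \sum_(tau in T) (\sum_(u in tau) vsign R u tau * y (tau :\ u)) ^+ 2 =
  \sum_(sigma : {set V})
    #|[set u | (u \notin sigma) && (u |: sigma \in T)]|%:R * y sigma ^+ 2
  - \sum_(eta : {set V}) \sum_u \sum_v
      [&& u != v, u \notin eta, v \notin eta & u |: (v |: eta) \in T]%:R
      * (annih u y eta * annih v y eta).
Proof.
(* The terms u = v and u <> v of the expanded square, indexed by what is left of tau after deleting
   u, respectively u and v. *)
pose diag u eta : R := (u |: eta \in T)%:R * y eta ^+ 2.
pose off u v eta : R := [&& u != v, u \notin eta & u |: (v |: eta) \in T]%:R *
  (vsign R u (u |: (v |: eta)) * y (v |: eta) *
   (vsign R v (u |: (v |: eta)) * y (u |: eta))).
transitivity (\sum_(tau : {set V}) \sum_(u in tau) (diag u (tau :\ u) +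
     \sum_(v in tau :\ u) off u v (tau :\ u :\ v))).
  rewrite big_mkcond; apply: eq_bigr => tau _.
  case: ifPn => tau_T; last first.
    rewrite big1// => u u_tau; rewrite /diag setD1K// (negPf tau_T) mul0r add0r.
    rewrite big1// => v v_tau; rewrite /off setD1K// setD1K// (negPf tau_T).
    by rewrite !andbF mul0r.
  rewrite expr2 mulr_suml; apply: eq_bigr => u u_tau; rewrite mulr_sumr.
  rewrite (bigD1 u)//=; congr (_ + _).
    rewrite /diag setD1K// tau_T mul1r -[RHS]mul1r -(vsign_sqr R u tau).
    by ring.
  apply: eq_big => v; first by rewrite !inE andbC.
  move=> /andP[v_tau vu]; have v_tau' : v \in tau :\ u by rewrite !inE vu.
  rewrite /off setD1K// setD1K// tau_T !inE eqxx eq_sym vu andbF /= mul1r.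
  have -> : u |: (tau :\ u :\ v) = tau :\ v.
    apply/setP => w; rewrite !inE; case: eqVneq => [->|]//=.
    by rewrite u_tau eq_sym vu.
  by [].
under eq_bigr do rewrite big_split /=.
rewrite big_split /=; congr (_ + _).
  rewrite -(sum_setU1_setD1 diag); apply: eq_bigr => eta _.
  rewrite /diag -mulr_suml -natr_sum -sum1_card; congr (_%:R * _).
  rewrite big_mkcond [RHS]big_mkcond; apply: eq_bigr => u _; rewrite inE.
  by case: (u \in eta) => //=; case: (_ \in T).
rewrite -(sum_setU1_setD1 (fun u zeta => \sum_(v in zeta) off u v (zeta :\ v))).
transitivity
  (\sum_u \sum_(zeta : {set V}) \sum_(v in zeta) off u v (zeta :\ v)).
  rewrite exchange_big; apply: eq_bigr => zeta _ /=.
  rewrite big_mkcond; apply: eq_bigr => u _; case: ifPn => //; rewrite negbK.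
  move=> u_zeta; rewrite big1// => v v_zeta; rewrite /off !inE u_zeta andbT.
  by case: eqVneq; rewrite /= mul0r.
rewrite -sumrN.
rewrite [RHS](eq_bigr (fun eta => \sum_u \sum_(v | v \notin eta) off u v eta)).
  rewrite [RHS]exchange_big; apply: eq_bigr => u _.
  by rewrite -(sum_setU1_setD1 (off u)).
move=> eta _; rewrite -sumrN; apply: eq_bigr => u _.
rewrite -sumrN [RHS]big_mkcond; apply: eq_bigr => v _; rewrite /off !ffunE.
have [->|uv] := eqVneq u v; first by rewrite !mul0r oppr0 if_same.
have [u_eta|u_eta] := boolP (u \in eta); first by rewrite !mul0r oppr0 if_same.
have [v_eta|v_eta] := boolP (v \in eta); first by rewrite !mul0r oppr0.
rewrite /= -mulrN; congr (_ * _).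
rewrite vsign_self setUCA vsign_self.
(* The signs of u and v in tau multiply to minus the product of their signs in eta, whence the minus
   in the statement. *)
have := vsign_swap R uv u_eta v_eta.
set p := vsign R u (v |: eta); set q := vsign R v (u |: eta) => pq.
transitivity (p * q * (y (u |: eta) * y (v |: eta))); last by ring.
by rewrite pq; ring.
Qed.
End Incidence.

(** * Comparison of the Laplacian with the compound of L(G_X) + J *)

Section Laplacian.
Variables (R : rcfType) (d : Order.disp_t) (V : finOrderType d).
Implicit Types (y : {ffun {set V} -> R}) (eta sigma tau : {set V}).
Implicit Types (u v w : V).

(** Chains on [T] enter the exterior algebra as functions vanishing off [T]. *)
Definition extend0 (T : {set {set V}}) (x : 'rV[R]_#|T|) :
    {ffun {set V} -> R} :=
  [ffun sigma => \sum_a x 0 a * (enum_val a == sigma)%:R].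

Lemma extend0_out (T : {set {set V}}) (x : 'rV[R]_#|T|) sigma :
  sigma \notin T -> extend0 x sigma = 0.
Proof.
move=> sigma_T; rewrite ffunE big1// => a _.
by case: eqVneq sigma_T => [<-|_ _]; rewrite ?enum_valP ?mulr0.
Qed.

Lemma extend0_enum_val (T : {set {set V}}) (x : 'rV[R]_#|T|) a :
  extend0 x (enum_val a) = x 0 a.
Proof.
rewrite ffunE (bigD1 a)//= eqxx mulr1 big1 ?addr0// => b ba.
by rewrite (inj_eq enum_val_inj) (negPf ba) mulr0.
Qed.

Lemma sum_extend0 (T : {set {set V}}) (x : 'rV[R]_#|T|) (F : {set V} -> R) :
  \sum_a x 0 a * F (enum_val a) = \sum_sigma extend0 x sigma * F sigma.
Proof.
rewrite [RHS](bigID (mem T)) /= [X in _ + X]big1 ?addr0; last first.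
  by move=> sigma sigma_T; rewrite extend0_out ?mul0r.
rewrite [RHS]big_enum_val; apply: eq_bigr => a _.
by rewrite extend0_enum_val.
Qed.

Lemma sqnorm_extend0 (T : {set {set V}}) (x : 'rV[R]_#|T|) :
  sqnorm (extend0 x) = \sum_a x 0 a ^+ 2.
Proof.
transitivity (\sum_a x 0 a * extend0 x (enum_val a)).
  by rewrite sum_extend0; apply: eq_bigr => sigma _; rewrite expr2.
by apply: eq_bigr => a _; rewrite extend0_enum_val expr2.
Qed.

Section Complex.
Variables (X : {set {set V}}) (k : nat).
Hypothesis X_complex : simplicial_complex X.

Lemma laplacian_sym : (laplacian R X k)^T = laplacian R X k.
Proof. by rewrite /laplacian linearD /= !trmx_mul !trmxK. Qed.

Lemma extend0_homogeneous (x : 'rV[R]_#|faces X k.+1|) :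
  homogeneous k.+1 (extend0 x).
Proof.
move=> sigma sigma_k; apply: extend0_out.
by rewrite inE negb_and sigma_k orbT.
Qed.

Lemma laplacian_form (x : 'rV[R]_#|faces X k.+1|) (y := extend0 x) :
  (x *m laplacian R X k *m x^T) 0 0 =
  \sum_(tau in faces X k.+2)
     (\sum_(u in tau) vsign R u tau * y (tau :\ u)) ^+ 2
  + \sum_(eta : {set V}) (\sum_u annih u y eta) ^+ 2.
Proof.
rewrite /laplacian mulmxDr mulmxDl mxE; congr (_ + _).
  rewrite mulmxA -mulmxA -trmx_mul mxE [RHS]big_enum_val; apply: eq_bigr => j _.
  rewrite [X in _ * X]mxE -expr2; congr (_ ^+ 2).
  have tau_card : #|enum_val j| = k.+2.
    by have := enum_valP j; rewrite inE => /andP[_ /eqP].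
  rewrite -(sum_incidence_sub (extend0_homogeneous x) tau_card) -sum_extend0.
  rewrite mxE; by apply: eq_bigr => a _; rewrite mxE.
transitivity (\sum_(eta in faces X k) (\sum_u annih u y eta) ^+ 2).
  rewrite mulmxA -mulmxA -[X in (_ *m X) 0 0]trmxK trmx_mul trmxK mxE.
  rewrite [RHS]big_enum_val.
  apply: eq_bigr => j _; rewrite [X in _ * X]mxE -expr2; congr (_ ^+ 2).
  have eta_card : #|enum_val j| = k.
    by have := enum_valP j; rewrite inE => /andP[_ /eqP].
  rewrite -(sum_incidence_sup (extend0_homogeneous x) eta_card) -sum_extend0.
  rewrite mxE; by apply: eq_bigr => a _; rewrite !mxE.
(* As X is closed under subsets, an eta outside [faces X k] is not a facet of any face in
   [faces X k.+1], so every contraction vanishes at it. *)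
rewrite big_mkcond; apply: eq_bigr => eta _; case: ifPn => // eta_out.
rewrite big1 ?expr0n// => u _; rewrite ffunE; case: ifPn => // u_eta.
rewrite /y extend0_out ?mulr0//; apply: contra eta_out; rewrite !inE.
rewrite cardsU1 u_eta eqSS => /andP[Xu ->]; rewrite andbT.
by case: X_complex => _ /(_ _ _ Xu); apply; apply: subsetUr.
Qed.

Lemma skeletonE u v : skeleton X u v = (u != v) && ([set u; v] \in X).
Proof.
rewrite /skeleton inE cards2.
by case: eqVneq => //=; rewrite andbT.
Qed.

Lemma skeleton_sym u v : skeleton X u v = skeleton X v u.
Proof. by rewrite !skeletonE eq_sym setUC. Qed.

Definition degree u := #|[set w | skeleton X u w]|.

Lemma compound_form_graph y :
  compound_form (fun u v =>
    (graph_laplacian R (skeleton X) + const_mx 1) (enum_rank u) (enum_rank v))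
    y =
  \sum_(sigma : {set V}) (\sum_(u in sigma) degree u)%:R * y sigma ^+ 2
  - \sum_(eta : {set V}) \sum_u \sum_v
      (skeleton X u v)%:R * (annih u y eta * annih v y eta)
  + \sum_(eta : {set V}) (\sum_u annih u y eta) ^+ 2.
Proof.
transitivity (\sum_(eta : {set V}) \sum_u \sum_v
   ((if u == v then (degree u)%:R else 0) * (annih u y eta * annih v y eta)
   - (skeleton X u v)%:R * (annih u y eta * annih v y eta)
   + annih u y eta * annih v y eta)).
  apply: eq_bigr => eta _; apply: eq_bigr => u _; apply: eq_bigr => v _.
  rewrite !mxE !enum_rankK skeletonE; case: eqVneq => [->|uv] /=.
    by rewrite eqxx /degree; ring.
  by rewrite (negPf uv) skeletonE uv /=; case: (_ \in X) => /=; ring.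
have -> : \sum_(sigma : {set V}) (\sum_(u in sigma) degree u)%:R * y sigma ^+ 2
  = \sum_(eta : {set V}) \sum_u \sum_v
   (if u == v then (degree u)%:R else 0) * (annih u y eta * annih v y eta).
  under [LHS]eq_bigr do rewrite natr_sum.
  rewrite -(sum_annih_sqr (fun u _ => (degree u)%:R)).
  apply: eq_bigr => eta _; apply: eq_bigr => u _.
  rewrite [RHS](bigD1 u)//= eqxx big1 ?addr0 -?expr2// => v vu.
  by rewrite eq_sym (negPf vu) mul0r.
rewrite -sumrB -big_split /=; apply: eq_bigr => eta _.
rewrite expr2 mulr_suml -sumrB -big_split /=; apply: eq_bigr => u _.
by rewrite mulr_sumr -sumrB -big_split.
Qed.

Lemma link_vertex sigma u :
  ([set u] \in link X sigma) = (u \notin sigma) && (u |: sigma \in X).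
Proof.
case: X_complex => Xv _; rewrite inE Xv setUC /= andbC; congr (_ && _).
by rewrite setI_eq0 disjoint_sym disjoints1.
Qed.

(* The vertices v such that sigma and sigma - u + v are joined by an entry of *)
(* the Laplacian that does not occur in the compound matrix.                  *)
Definition exchange sigma u : {set V} :=
  [set v | [&& v \notin sigma, skeleton X u v, v |: sigma \notin X
                & v |: (sigma :\ u) \in X]].

(** If v is in sigma, it is not adjacent to itself; if it misses some u in sigma, no exchange is
    possible, since sigma - w + v would contain the non-edge uv for w <> u. Either way the left side
    is at most k. If sigma + v is a face there is no exchange and k + 1 suffices. Otherwise v lies
    in sigma[j] and k + 1 adjacencies plus j exchanges make k + (j + 1). *)
Lemma vertex_count sigma v : sigma \in faces X k.+1 ->
  (\sum_(u in sigma) skeleton X u v + \sum_(u in sigma) (v \in exchange sigma u)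
  <= ((v \notin sigma) && (v |: sigma \in X)) + k
     + \sum_(0 <= j < k.+2) j.+1 * (v \in missing X sigma j))%N.
Proof.
rewrite inE => /andP[X_sigma /eqP sigma_card].
have skel_sum : (\sum_(u in sigma) skeleton X u v <= k.+1)%N.
  rewrite -sigma_card -sum1_card; apply: leq_sum => u _; exact: leq_b1.
have skel_sum_lt u : u \in sigma -> ~~ skeleton X u v ->
    (\sum_(u in sigma) skeleton X u v <= k)%N.
  move=> u_sigma /negPf uv; rewrite (bigD1 u)//= uv add0n.
  have -> : k = (\sum_(w in sigma | w != u) 1)%N.
    have := sum1_card (mem sigma); rewrite (bigD1 u)//= => e.
    by rewrite sigma_card in e; case: e.
  apply: leq_sum => w _; exact: leq_b1.
have [v_sigma|v_sigma] := boolP (v \in sigma).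
  rewrite [X in (_ + X <= _)%N]big1; last by move=> u _; rewrite inE v_sigma.
  rewrite addn0 add0n (leq_trans _ (leq_addr _ _))//.
  by apply: (skel_sum_lt v) => //; rewrite skeletonE eqxx.
have [Xv|Xv] := boolP (v |: sigma \in X).
  rewrite [X in (_ + X <= _)%N]big1; last by move=> u _; rewrite inE Xv !andbF.
  by rewrite addn0 add1n (leq_trans skel_sum)// leq_addr.
rewrite add0n.
have skelE u : u \in sigma -> skeleton X u v = ([set v] \in link X [set u]).
  move=> u_sigma; rewrite link_vertex inE skeletonE eq_sym setUC.
  by [].
have [/forallP/= all_adj|] :=
  boolP [forall u, (u \in sigma) ==> skeleton X u v].
  pose j := #|[set w in sigma | [set v] \in link X (sigma :\ w)]|.
  have j_lt : (j < k.+2)%N.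
    rewrite ltnS -sigma_card subset_leq_card//.
    by apply/subsetP => w; rewrite inE => /andP[].
  have v_missing : v \in missing X sigma j.
    rewrite inE eqxx andbT link_vertex (negPf Xv) andbF /=.
    apply/forallP => u; apply/implyP => u_sigma.
    by rewrite -skelE//; apply: (implyP (all_adj u)).
  have exch_sum : (\sum_(u in sigma) (v \in exchange sigma u) <= j)%N.
    rewrite /j -sum1_card [leqRHS]big_mkcond [leqLHS]big_mkcond.
    apply: leq_sum => u _; rewrite [u \in [set _ in _ | _]]in_set link_vertex.
    case: ifP => // u_sigma; rewrite !inE (negPf v_sigma) andbF /=.
    by case: (_ |: (_ :\ u) \in X); rewrite ?andbF ?leq_b1.
  have le_missing :
      (j.+1 <= \sum_(0 <= j < k.+2) j.+1 * (v \in missing X sigma j))%N.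
    rewrite (bigD1_seq j) ?iota_uniq ?mem_index_iota//= v_missing muln1.
    exact: leq_addr.
  by rewrite (leq_trans (leq_add skel_sum exch_sum))// addSnnS leq_add2l.
rewrite negb_forall => /existsP[u]; rewrite negb_imply => /andP[u_sigma uv].
rewrite [X in (_ + X <= _)%N]big1.
  by rewrite addn0 (leq_trans (skel_sum_lt u u_sigma uv))// leq_addr.
move=> w w_sigma; rewrite inE; apply/eqP; rewrite eqb0.
apply: contra (uv) => /and4P[_ wv _ Xw].
have uw : u != w by apply: contraNneq uv => ->.
rewrite skeletonE; apply/andP; split.
  by apply: contraNneq v_sigma => <-.
case: X_complex => _ /(_ _ _ Xw); apply.
by rewrite subUset !sub1set !inE eqxx uw u_sigma orbT.
Qed.

Lemma face_count sigma : sigma \in faces X k.+1 ->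
  (\sum_(u in sigma) degree u + \sum_(u in sigma) #|exchange sigma u|
  <= #|[set v | (v \notin sigma) && (v |: sigma \in faces X k.+2)]| + k * #|V|
     + \sum_(0 <= j < k.+2) j.+1 * #|missing X sigma j|)%N.
Proof.
move=> sigma_face.
have cardE (A : {set V}) : #|A| = (\sum_v (v \in A))%N.
  by rewrite -sum1_card big_mkcond; apply: eq_bigr => v _; case: (v \in A).
have sum_card (F : V -> {set V}) :
    (\sum_(u in sigma) #|F u| = \sum_v \sum_(u in sigma) (v \in F u))%N.
  by rewrite exchange_big; apply: eq_bigr => u _; apply: cardE.
rewrite /degree (sum_card (fun u => [set w | skeleton X u w])) sum_card.
rewrite -big_split.
have -> : (\sum_(0 <= j < k.+2) j.+1 * #|missing X sigma j| =
    \sum_v \sum_(0 <= j < k.+2) j.+1 * (v \in missing X sigma j))%N.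
  rewrite exchange_big; apply: eq_bigr => j _ /=.
  by rewrite cardE big_distrr.
have -> : (k * #|V| = \sum_(v : V) k)%N by rewrite sum_nat_const mulnC.
rewrite cardE -!big_split; apply: leq_sum => v _ /=.
have -> : (\sum_(u in sigma) (v \in [set w | skeleton X u w]) =
           \sum_(u in sigma) skeleton X u v)%N.
  by apply: eq_bigr => u _; rewrite inE.
have -> : (v \in [set v | (v \notin sigma) && (v |: sigma \in faces X k.+2)]) =
    (v \notin sigma) && (v |: sigma \in X).
  move: sigma_face; rewrite !inE => /andP[_ /eqP sigma_card].
  by case: (boolP (v \in sigma)) => //= v_sigma;
     rewrite cardsU1 v_sigma sigma_card eqxx andbT.
exact: vertex_count.
Qed.

Lemma laplacian_form_ge (x : 'rV[R]_#|faces X k.+1|)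
    (c := (\max_(sigma in faces X k.+1)
      \sum_(0 <= j < k.+2) j.+1 * #|missing X sigma j|)%N) :
  compound_form (fun u v =>
    (graph_laplacian R (skeleton X) + const_mx 1) (enum_rank u) (enum_rank v))
      (extend0 x) - (k * #|V| + c)%:R * sqnorm (extend0 x)
  <= (x *m laplacian R X k *m x^T) 0 0.
Proof.
rewrite laplacian_form compound_form_graph sum_coboundary_sqr.
set y := extend0 x.
have y_out sigma : sigma \notin faces X k.+1 -> y sigma = 0.
  exact: extend0_out.
pose up sigma := #|[set v | (v \notin sigma) && (v |: sigma \in faces X k.+2)]|.
(* The edges of the compound form that no coface in the upper Laplacian matches. *)
pose bad u v eta := [&& skeleton X u v, u \notin eta, v \notin eta,
  u |: (v |: eta) \notin X, u |: eta \in X & v |: eta \in X].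
pose S := \sum_(eta : {set V}) \sum_u
  (\sum_v (bad u v eta)%:R) * annih u y eta ^+ 2.
(* With eta = sigma - u, [bad u v eta] forces v into [exchange sigma u]. *)
have S_le : S <= \sum_(sigma : {set V})
    (\sum_(u in sigma) #|exchange sigma u|)%:R * y sigma ^+ 2.
  rewrite /S (sum_annih_sqr (fun u eta => \sum_v (bad u v eta)%:R)).
  apply: ler_sum => sigma _; rewrite ler_wpM2r ?sqr_ge0// natr_sum.
  apply: ler_sum => u u_sigma; rewrite -natr_sum ler_nat.
  rewrite -sum1_card [leqRHS]big_mkcond; apply: leq_sum => v _.
  case: ifP => [_|]; first exact: leq_b1.
  move=> /negbT; rewrite /exchange /bad inE.
  rewrite setUCA setD1K// skeletonE !inE.
  case: (eqVneq u v) => //= uv.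
  case: (v \in sigma) => /=; first by rewrite !andbF.
  by rewrite leqn0 eqb0; apply: contra => /and5P[-> _ -> _ ->].
have cross_le : \sum_(eta : {set V}) \sum_u \sum_v
      [&& u != v, u \notin eta, v \notin eta
        & u |: (v |: eta) \in faces X k.+2]%:R
      * (annih u y eta * annih v y eta) -
   \sum_(eta : {set V}) \sum_u \sum_v
      (skeleton X u v)%:R * (annih u y eta * annih v y eta) <= S.
  (* [bad] is symmetric in u and v, so [S] can be averaged over the two orders to match AM-GM
     termwise. *)
  have S_sym : S = \sum_(eta : {set V}) \sum_u \sum_v
     (bad u v eta)%:R * ((annih u y eta ^+ 2 + annih v y eta ^+ 2) / 2).
    apply: eq_bigr => eta _.
    pose T := \sum_u \sum_v (bad u v eta)%:R * annih u y eta ^+ 2.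
    have -> : \sum_u (\sum_v (bad u v eta)%:R) * annih u y eta ^+ 2 = T.
      by apply: eq_bigr => u _; rewrite mulr_suml.
    have T' : T = \sum_u \sum_v (bad u v eta)%:R * annih v y eta ^+ 2.
      rewrite /T exchange_big; apply: eq_bigr => u _; apply: eq_bigr => v _.
      congr (_%:R * _); rewrite /bad skeleton_sym setUCA.
      congr (nat_of_bool (_ && _)); case: (u \in eta); case: (v \in eta) => //=.
      by congr (_ && _); rewrite andbC.
    have -> : T = (T + T) / 2 by lra.
    rewrite {2}T' /T -big_split mulr_suml; apply: eq_bigr => u _.
    by rewrite -big_split mulr_suml; apply: eq_bigr => v _ /=; ring.
  rewrite S_sym -sumrB; apply: ler_sum => eta _; rewrite -sumrB.
  apply: ler_sum => u _; rewrite -sumrB; apply: ler_sum => v _.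
  have annih0 w : annih w y eta != 0 ->
      [&& w \notin eta, w |: eta \in X & #|eta| == k].
    rewrite ffunE; case: ifPn => [_|w_eta]; first by rewrite eqxx.
    apply: contraNT => /= w_out; rewrite y_out ?mulr0// inE cardsU1 w_eta.
    by rewrite eqSS.
  set au := annih u y eta; set av := annih v y eta.
  have sq : 0 <= (au ^+ 2 + av ^+ 2) / 2.
    by rewrite divr_ge0// addr_ge0// sqr_ge0.
  have [au0|/annih0/and3P[u_eta Xu eta_k]] := eqVneq au 0.
    apply: le_trans (mulr_ge0 (ler0n _ _) sq).
    by rewrite au0 mul0r !mulr0 subrr.
  have [av0|/annih0/and3P[v_eta Xv _]] := eqVneq av 0.
    apply: le_trans (mulr_ge0 (ler0n _ _) sq).
    by rewrite av0 !mulr0 subrr.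
  rewrite /bad u_eta v_eta Xu Xv /= !andbT skeletonE.
  case: (eqVneq u v) => [->|uv] /=; first by rewrite mul0r subrr mul0r.
  have -> : (u |: (v |: eta) \in faces X k.+2) = (u |: (v |: eta) \in X).
    by rewrite inE cardsU1 !inE (negPf uv) (negPf u_eta) cardsU1 v_eta
               (eqP eta_k) eqxx andbT.
  (* If eta + u + v is a face, then uv is an edge and the two cross terms cancel; otherwise - au *
     av is at most the mean of the squares. *)
  have [Xuv|Xuv] := boolP (u |: (v |: eta) \in X).
    have -> : [set u; v] \in X.
      case: X_complex => _ /(_ _ _ Xuv); apply; rewrite subUset !sub1set !inE.
      by rewrite !eqxx orbT.
    by rewrite subrr mul0r.
  have := sqr_ge0 (au + av); rewrite andbT.
  by case: (_ \in X) => /=; lra.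
have diag_le :
   \sum_(sigma : {set V}) (\sum_(u in sigma) degree u)%:R * y sigma ^+ 2
   + \sum_(sigma : {set V})
       (\sum_(u in sigma) #|exchange sigma u|)%:R * y sigma ^+ 2
   <= \sum_(sigma : {set V}) (up sigma)%:R * y sigma ^+ 2
      + (k * #|V| + c)%:R * sqnorm y.
  rewrite mulr_sumr -!big_split; apply: ler_sum => sigma _ /=.
  have [sigma_face|/y_out ->] := boolP (sigma \in faces X k.+1); last first.
    by rewrite expr0n !mulr0.
  rewrite -!mulrDl -!natrD ler_wpM2r ?sqr_ge0// ler_nat.
  apply: (leq_trans (face_count sigma_face)); rewrite -addnA !leq_add2l.
  exact: (leq_bigmax_cond _ sigma_face).
rewrite -/up.
lra.
Qed.

End Complex.
End Laplacian.

Unset Implicit Arguments.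

Theorem theorem1p4 (R : realType) (d : Order.disp_t) (V : finOrderType d)
    (X : {set {set V}}) (n : nat) (hX : simplicial_complex X)
    (hn : #|V| = n) (k i : nat) (hi : (1 <= i <= #|faces X k.+1|)%N) :
  eigenval (laplacian R X k) i >=
    eigensum (graph_laplacian R (skeleton X) + const_mx 1) k.+1 i
    - (k * n)%:R
    - (\max_(sigma in faces X k.+1)
         \sum_(0 <= j < k.+2) j.+1 * #|missing X sigma j|)%N%:R.
Proof.
case/andP: hi => i_gt0 i_le; set M := graph_laplacian _ _ + _.
have M_sym : M^T = M.
  apply/matrixP => a b; rewrite !mxE /=.
  case: (eqVneq (enum_val b : V) (enum_val a)) => [->//|ba].
  by rewrite skeleton_sym.
have [G GP] := eigensum_le_form k.+1 i M_sym.
(* The left kernel of [B] consists of the chains killed by the i - 1 functionals [G]. *)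
pose B : 'M[R]_(#|faces X k.+1|, i.-1) := \matrix_(a, j) G j (enum_val a).
apply: (eigenval_ge (r := i.-1) (B := B)) => //; first exact: laplacian_sym.
  by rewrite prednK.
move=> x xB; apply: le_trans (laplacian_form_ge hX x).
have xG j : \sum_sigma G j sigma * extend0 x sigma = 0.
  have /rowP/(_ j) := xB; rewrite mxE [RHS]mxE => xB0; rewrite -[RHS]xB0.
  under [LHS]eq_bigr do rewrite mulrC.
  by rewrite -sum_extend0; apply: eq_bigr => a _; rewrite mxE.
have := GP _ (extend0_homogeneous x) xG.
rewrite -/M -sqnorm_extend0 -hn natrD; lra.
Qed.
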